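(* Let $T$ be a finite rooted tree with node set $\mathcal V$, cost function $c:\mathcal V\to\mathbb R_{\ge0}$, integer budget $B\ge1$, and importance function $r:\mathcal V\to\mathbb R_{>0}$. Let $\mathbf v$ be a hypernode with $S(\mathbf v)\ne\emptyset$. Then \[\mathrm{Var}\big(|\mathbf v|C_{\mathrm{SEI}}(T_{\mathbf v})\big)=\sum_{\mathbf w\in H(\mathbf v)}\frac{1}{\binom{|S(\mathbf v)|-1}{|\mathbf w|-1}}\frac{r(S(\mathbf v))}{r(\mathbf w)}\Big(\mathrm{Var}\big(|\mathbf w|C_{\mathrm{SEI}}(T_{\mathbf w})\big)+\mathrm{Cost}(T_{\mathbf w})^2\Big)-\mathrm{Cost}(T_{S(\mathbf v)})^2,\] where $C_{\mathrm{SEI}}(T_{\mathbf u})$ denotes the output of the SEI algorithm started at the hypernode $\mathbf u$.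
   Context: For a node $v$, $S(v)$ is its set of children and $T_v$ is the subtree rooted at $v$, with $\mathrm{Cost}(T_v)=\sum_{u\in T_v}c(u)$. A hypernode is a set of distinct nodes of $T$ all at the same depth. For a set of nodes $\mathbf v$: $c(\mathbf v)=\sum_{v\in\mathbf v}c(v)$, $r(\mathbf v)=\sum_{v\in\mathbf v}r(v)$, $S(\mathbf v)=\bigcup_{v\in\mathbf v}S(v)$, $T_{\mathbf v}=\bigcup_{v\in\mathbf v}T_v$, and $\mathrm{Cost}(T_{\mathbf v})=\sum_{v\in\mathbf v}\mathrm{Cost}(T_v)$. The hyperchildren of $\mathbf v$ are $H(\mathbf v)=\{\mathbf w\subseteq S(\mathbf v): |\mathbf w|=\min(B,|S(\mathbf v)|)\}$. SEI algorithm started at $\mathbf v$: set $k=0$, $\mathbf x_0=\mathbf v$, $D=1$, $C=c(\mathbf x_0)/|\mathbf x_0|$. Repeat: if $S(\mathbf x_k)=\emptyset$, stop and output $C_{\mathrm{SEI}}(T_{\mathbf v})=C$. Otherwise choose $\mathbf x_{k+1}\in H(\mathbf x_k)$ by first choosing $x\in S(\mathbf x_k)$ with probability $r(x)/r(S(\mathbf x_k))$ and then choosing the remaining $\min(B,|S(\mathbf x_k)|)-1$ elements of $\mathbf x_{k+1}$ as a uniformly random subset of $S(\mathbf x_k)\setminus\{x\}$ (fresh randomness at each step); set $D_k=\frac{|\mathbf x_{k+1}|}{|\mathbf x_k|}\cdot\frac{r(S(\mathbf x_k))}{r(\mathbf x_{k+1})}$, $D\leftarrow D\cdot D_k$, $C\leftarrow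 C+\frac{c(\mathbf x_{k+1})}{|\mathbf x_{k+1}|}D$, $k\leftarrow k+1$. *)

(* Defs.v *)
From HB Require Import structures.
From mathcomp Require Import all_boot all_order all_algebra.
From mathcomp Require Import all_classical all_reals all_analysis.

Set Implicit Arguments.
Unset Strict Implicit.
Unset Printing Implicit Defensive.

Import Order.TTheory GRing.Theory Num.Theory.
Import numFieldNormedType.Exports.

Local Open Scope ring_scope.

(* The last field makes the parent map acyclic and the root its only orphan:
   iterating [parent] from any node reaches [root], whose parent is [None]. *)
Record rooted_tree (V : finType) := RootedTree {
  root : V;
  parent : V -> option V;
  parent_root : parent root = None;
  parent_reach : forall v : V,
    exists k, iter k (obind parent) (Some v) == Some root }.

Section Tree.
Context {V : finType} (T : rooted_tree V).

Definition depth (v : V) : nat := ex_minn (parent_reach T v).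

Definition height : nat := (\max_(v : V) depth v)%N.

Definition child_of : rel V := [rel v u | parent T u == Some v].

Definition children (v : V) : {set V} := [set u | child_of v u].

Definition subtree (v : V) : {set V} := [set u | connect child_of v u].

Definition hypernode (x : {set V}) : bool :=
  [forall u in x, forall v in x, depth u == depth v].

Definition children_set (x : {set V}) : {set V} :=
  \bigcup_(v in x) children v.

Definition hyperchildren (B : nat) (x : {set V}) : {set {set V}} :=
  [set w : {set V} |
    (w \subset children_set x) && (#|w| == minn B #|children_set x|)].

Lemma depth_parent (u v : V) : parent T u = Some v -> depth u = (depth v).+1.
Proof.
move=> puv; rewrite /depth.
case: (ex_minnP (parent_reach T u)) => -[|k] /eqP ku mink.
  by case: ku puv => ->; rewrite parent_root.
case: (ex_minnP (parent_reach T v)) => d /eqP dv mind.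
rewrite iterSr /= puv in ku.
apply/eqP; rewrite eqSS eqn_leq mind ?ku // andbT -ltnS.
by apply: mink; rewrite iterSr /= puv dv.
Qed.

Lemma children_setS (x y : {set V}) :
  x \subset y -> children_set x \subset children_set y.
Proof.
move=> xy; apply/bigcupsP => v vx; apply: (bigcup_max v) => //.
exact: (fintype.subsetP xy).
Qed.

Lemma iter_children_setS n (x y : {set V}) :
  x \subset y -> iter n children_set x \subset iter n children_set y.
Proof. by elim: n => //= n IH xy; apply/children_setS/IH. Qed.

Lemma iter_children_set0 (x : {set V}) :
  iter height.+1 children_set x = finset.set0.
Proof.
have le_depth n u : u \in iter n children_set x -> (n <= depth u)%N.
  elim: n u => //= n IH u /bigcupP[v vn]; rewrite inE /= => /eqP puv.
  by rewrite (depth_parent puv) ltnS IH.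
apply/eqP; rewrite -finset.subset0; apply/fintype.subsetP => u /le_depth.
by rewrite ltnNge leq_bigmax.
Qed.

End Tree.

(* Instantiated below with both the costs, c(x), and the importances, r(x). *)
Definition node_sum {R : realType} {V : finType} (f : V -> R)
    (x : {set V}) : R :=
  \sum_(v in x) f v.

Definition cost {R : realType} {V : finType} (T : rooted_tree V) (c : V -> R)
    (v : V) : R :=
  \sum_(u in subtree T v) c u.

Definition cost_set {R : realType} {V : finType} (T : rooted_tree V)
    (c : V -> R) (x : {set V}) : R :=
  \sum_(v in x) cost T c v.

Section Mixture.
Local Open Scope ereal_scope.
Context {d : measure_display} {X : measurableType d} {R : realType}.
Context {I : finType} (A : {set I}) (p : I -> {nonneg R}).
Variable mu : I -> {measure set X -> \bar R}.

(* The law of a random variable drawn from [mu i], the index [i] being itself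
   random with probability [p i] for each [i] in [A]. *)
Definition mixture (U : set X) : \bar R :=
  \sum_(i in A) (p i)%:num%:E * mu i U.

Let mixture0 : mixture classical_sets.set0 = 0.
Proof. by rewrite /mixture big1// => i _; rewrite measure0 mule0. Qed.

Let mixture_ge0 U : 0 <= mixture U.
Proof. by apply: sume_ge0 => i _; rewrite mule_ge0. Qed.

Let mixture_sigma_additive : semi_sigma_additive mixture.
Proof.
move=> F mF tF mUF.
rewrite [X in (X @ \oo --> _)%classic](_ : _ = fun n =>
    \sum_(i in A) \sum_(0 <= k < n) (mscale (p i) (mu i)) (F k)); last first.
  by apply/funext => n; rewrite /mixture exchange_big.
apply: cvg_nnesum => [i _|i _]; last exact: measure_semi_sigma_additive.
by apply: nearW => n; apply: sume_ge0 => k _.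
Qed.

HB.instance Definition _ := isMeasure.Build _ _ _ mixture
  mixture0 mixture_ge0 mixture_sigma_additive.

Lemma mixture_setT : (\sum_(i in A) (p i)%:num = 1)%R ->
  (forall i, i \in A -> mu i classical_sets.setT = 1) ->
  mixture classical_sets.setT = 1.
Proof.
move=> p1 mu1; rewrite /mixture (eq_bigr (fun i => (p i)%:num%:E)).
  by rewrite sumEFin p1.
by move=> i iA; rewrite mu1 // mule1.
Qed.

End Mixture.

Section SEI.
Context {R : realType} {V : finType} (T : rooted_tree V) (B : nat).
Context (c r : V -> R) (hr : forall v, 0 < r v).

Local Notation S := (children_set T).

Lemma total_r_ge0 (x : {set V}) : 0 <= node_sum r x.
Proof. by apply: sumr_ge0 => v _; exact: ltW. Qed.

Lemma importance_prob_ge0 (x : {set V}) (y : V) : 0 <= r y / node_sum r x.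
Proof. by rewrite divr_ge0 ?total_r_ge0 ?ltW. Qed.

Definition importance_prob (x : {set V}) (y : V) : {nonneg R} :=
  NngNum (importance_prob_ge0 x y).

(* The possible sets of remaining elements of the next hypernode, once its
   first element [y] has been chosen. *)
Definition remainders (x : {set V}) (y : V) : {set {set V}} :=
  [set A : {set V} |
    (A \subset S x :\ y) && (#|A| == (minn B #|S x|).-1)].

Definition uniform_prob {I : finType} (A : {set I}) (_ : I) : {nonneg R} :=
  (#|A|%:R^-1)%:nng.

(* Law of the final value of C when the loop is entered in state (x, D, C).
   The first argument bounds the number of iterations; [height T + 1] of them
   always suffice, see [sei_loop_unfold]. *)
Fixpoint sei_loop (n : nat) (x : {set V}) (D C : R) :
    {measure set R -> \bar R} :=
  if n isn't n'.+1 then dirac C else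
  if S x == finset.set0 as _ return {measure set R -> \bar R} then dirac C
  else mixture (S x) (importance_prob (S x)) (fun y =>
       mixture (remainders x y) (uniform_prob (remainders x y)) (fun A =>
         let w := y |: A in
         let D' :=
           D * (#|w|%:R / #|x|%:R * (node_sum r (S x) / node_sum r w)) in
         sei_loop n' w D' (C + node_sum c w / #|w|%:R * D'))).

(* The law of the output C_SEI of the algorithm started at [x]. *)
Definition sei (x : {set V}) : set R -> \bar R :=
  sei_loop (height T).+1 x 1 (node_sum c x / #|x|%:R).

Lemma card_remainders_gt0 (x : {set V}) (y : V) :
  y \in S x -> (0 < #|remainders x y|)%N.
Proof.
move=> yx.
have := cards_draws (S x :\ y) (minn B #|S x|).-1.
have yS : [set y] \subset S x by rewrite finset.sub1set.
rewrite -/(remainders x y) => ->; rewrite bin_gt0 cardsDS//.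
by rewrite cards1 -subn1 leq_sub2r// geq_minr.
Qed.

Lemma sei_loop_setT n x D C : sei_loop n x D C classical_sets.setT = 1%E.
Proof.
elim: n x D C => [|n IH] x D C /=; first exact: diracT.
case: ifPn => [_|Sx0]; first exact: diracT.
apply: mixture_setT => [|y yx].
  rewrite /= -mulr_suml divff// gt_eqF//.
  case/set0Pn: Sx0 => y yx; rewrite /node_sum (big_setD1 y)//=.
  by rewrite ltr_wpDr ?total_r_ge0.
apply: mixture_setT => [|A _]; last exact: IH.
rewrite /= sumr_const -[LHS]mulr_natr mulVf// pnatr_eq0 -lt0n.
exact: card_remainders_gt0.
Qed.

HB.instance Definition _ (x : {set V}) := Measure.on (sei x).
HB.instance Definition _ (x : {set V}) :=
  Measure_isProbability.Build _ _ _ (sei x) (sei_loop_setT _ _ _ _).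

Lemma sei_loop_stable n m x D C U :
  iter n S x = finset.set0 -> (n <= m)%N ->
  sei_loop m x D C U = sei_loop n x D C U.
Proof.
elim: n m x D C => [|n IH] [|m] x D C //= Sn nm.
  by rewrite Sn /children_set big_set0 eqxx.
case: ifPn => // _; apply: eq_bigr => y yx; congr (_ * _)%E.
apply: eq_bigr => A; rewrite inE => /andP[Ay _]; congr (_ * _)%E.
apply: IH => //; apply/eqP; rewrite -finset.subset0 -Sn -iterS iterSr.
apply: iter_children_setS; rewrite finset.subUset finset.sub1set yx.
exact: fintype.subset_trans Ay (subsetDl _ _).
Qed.

Lemma sei_loop_unfold x D C U : let h := (height T).+1 in
  sei_loop h x D C U =
  if S x == finset.set0 then dirac C U
  else mixture (S x) (importance_prob (S x)) (fun y =>
       mixture (remainders x y) (uniform_prob (remainders x y)) (fun A =>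
         let w := y |: A in
         let D' :=
           D * (#|w|%:R / #|x|%:R * (node_sum r (S x) / node_sum r w)) in
         sei_loop h w D' (C + node_sum c w / #|w|%:R * D'))) U.
Proof.
move=> h; rewrite -(@sei_loop_stable h h.+1) ?iter_children_set0//=.
by case: ifPn.
Qed.

End SEI.

(* Main.v *)
(** One step of the algorithm gives, with [rho = r(S(v)) / r(w)],
      |v| C_SEI(T_v) = c(v) + rho * |w| C_SEI(T_w),
    where the hyperchild [w] is drawn with probability
    p(w) = r(w) / r(S(v)) / 'C(|S(v)| - 1, |w| - 1).  Since [p(w) * rho] is the
    inverse of that binomial coefficient, which counts the hyperchildren
    containing a given node of S(v), averaging the costs of the hyperchildren
    restores Cost(T_{S(v)}): by induction |v| C_SEI(T_v) has mean Cost(T_v).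
    Expanding the square of the centered one-step formula then gives the
    recursion, because [p(w) * rho ^ 2 = rho / 'C(|S(v)| - 1, |w| - 1)]. *)
Require Import Defs.
From mathcomp Require Import all_boot all_order all_algebra.
From mathcomp Require Import all_classical all_reals all_analysis.
From mathcomp Require Import measurable_realfun ring lra.
Import Order.TTheory GRing.Theory Num.Theory.
Local Open Scope ring_scope.

Set Implicit Arguments.
Unset Strict Implicit.
Unset Printing Implicit Defensive.

(** * Costs of subtrees, level by level *)

Lemma sum_disjoint_bigcup (U : nmodType) (I J : finType) (A : {set I})
    (F : I -> {set J}) (E : J -> U) :
  {in A &, forall i j, i != j -> [disjoint F i & F j]} ->
  \sum_(x in \bigcup_(i in A) F i) E x = \sum_(i in A) \sum_(x in F i) E x.
Proof.
move=> dF.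
(* Replacing [F i] by the empty set outside [A] makes the family disjoint over the whole index
   type. *)
have -> : \bigcup_(i in A) F i =
    \bigcup_i (if i \in A then F i else finset.set0).
  exact: big_mkcond.
rewrite partition_disjoint_bigcup.
  rewrite [RHS]big_mkcond; apply: eq_bigr => i _.
  by case: ifP => // _; rewrite big_set0.
move=> i j ij; case: ifP => iA; last by rewrite -finset.setI_eq0 finset.set0I.
case: ifP => jA; first exact: dF.
by rewrite -finset.setI_eq0 finset.setI0.
Qed.

Section TreeCost.
Context {R : realType} {V : finType} (T : rooted_tree V).

(** Parents are unique, so an ancestor is an iterate of [parent], and the depths fix how often to
    iterate. This gives the disjointness facts behind [costE]. *)
Lemma connect_ancestor (v u : V) : connect (child_of T) v u ->
  exists2 k, iter k (obind (parent T)) (Some u) = Some v &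
             depth T u = (depth T v + k)%N.
Proof.
case/connectP => p; elim/last_ind: p u => [|p w IH] u /=.
  by move=> _ ->; exists 0%N; rewrite ?addn0.
rewrite rcons_path last_rcons => /andP[/IH/(_ erefl)[k ek dk] /eqP pw] ->.
exists k.+1; first by rewrite iterSr /= pw.
by rewrite (depth_parent pw) dk addnS.
Qed.

Lemma subtreeE (v : V) :
  subtree T v = v |: \bigcup_(u in children T v) subtree T u.
Proof.
apply/setP => u; rewrite !inE; apply/idP/idP.
  case/connectP => -[|w p] /=; first by move=> _ ->; rewrite eqxx.
  case/andP => vw wp ul; apply/orP; right; apply/bigcupP; exists w.
    by rewrite inE.
  by rewrite inE; apply/connectP; exists p.
case/predU1P => [->|/bigcupP[w]]; first exact: connect0.
by rewrite !inE => vw; apply: connect_trans; apply: connect1.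
Qed.

Lemma costE (c : V -> R) (v : V) :
  cost T c v = c v + \sum_(u in children T v) cost T c u.
Proof.
rewrite /cost subtreeE big_setU1 /=; last first.
  (* A child of [v] is deeper than [v], so [v] cannot lie below it. *)
  apply/bigcupP => -[u]; rewrite !inE => /eqP /depth_parent dv.
  move=> /connect_ancestor[k _ /eqP].
  by rewrite dv addSn -addnS -[X in X == _]addn0 eqn_add2l.
congr (_ + _); apply: sum_disjoint_bigcup => u w.
rewrite !inE => /eqP/depth_parent du /eqP/depth_parent dw uw.
rewrite disjoint_subset; apply/fintype.subsetP => z; rewrite !inE.
(* The siblings [u] and [w] have equal depth, so a common descendant [z] reaches both after the same
   number of steps, forcing [u = w]. *)
move=> /connect_ancestor[k zu dzu]; apply/negP => /connect_ancestor[l zw dzw].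
move: dzw; rewrite dzu du dw => /addnI kl.
by move: zw; rewrite -kl zu => -[/eqP]; rewrite (negPf uw).
Qed.

Lemma cost_setE (c : V -> R) (x : {set V}) :
  cost_set T c x = node_sum c x + cost_set T c (children_set T x).
Proof.
rewrite /cost_set /node_sum /children_set sum_disjoint_bigcup.
  by rewrite -big_split /=; apply: eq_bigr => v _; exact: costE.
move=> u v _ _ uv; rewrite disjoint_subset; apply/fintype.subsetP => z.
rewrite !inE /= => /eqP zu; apply: contra uv.
by rewrite /child_of /= zu => /eqP[->].
Qed.

End TreeCost.

(** * Integration against a mixture *)

Section MixtureIntegral.
Local Open Scope ereal_scope.
Context {d : measure_display} {X : measurableType d} {R : realType}.
Context {I : finType}.

Lemma ge0_integral_mixture (A : {set I}) (p : I -> {nonneg R})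
    (mu : I -> {measure set X -> \bar R}) (f : X -> \bar R) :
  measurable_fun setT f -> (forall x, 0 <= f x) ->
  \int[mixture A p mu]_x f x = \sum_(i in A) (p i)%:num%:E * \int[mu i]_x f x.
Proof.
move=> mf f0.
(* [msum] runs over naturals, so [A] is enumerated; the default [mzero] is never reached below
   [#|A|]. *)
pose m_ n : {measure set X -> \bar R} :=
  if insub n is Some i then mscale (p (enum_val (i : 'I_#|A|))) (mu (enum_val i))
  else mzero.
rewrite (eq_measure_integral (msum m_ #|A|)); last first.
  move=> U _ _; rewrite /mixture /msum /= [LHS]big_enum_val /=.
  by apply: eq_bigr => i _; rewrite /m_ valK.
rewrite ge0_integral_measure_sum// [RHS]big_enum_val /=.
by apply: eq_bigr => i _; rewrite /m_ valK ge0_integral_mscale.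
Qed.

End MixtureIntegral.

(** * Counting and drawing hyperchildren *)

Section Hyperchildren.
Context {V : finType} (T : rooted_tree V) (B : nat) (hB : (1 <= B)%N).

Local Notation S := (children_set T).
Local Notation H := (hyperchildren T B).

Lemma card_hyperchild (x w : {set V}) : w \in H x -> #|w| = minn B #|S x|.
Proof. by rewrite inE => /andP[_ /eqP]. Qed.

Lemma card_hyperchild_gt0 (x w : {set V}) :
  S x != finset.set0 -> w \in H x -> (0 < #|w|)%N.
Proof. by move=> Sx /card_hyperchild ->; rewrite leq_min hB card_gt0. Qed.

Lemma mem_remainders (x A : {set V}) (y : V) : y \in S x ->
  (A \in remainders T B x y) = (y |: A \in H x) && (y \notin A).
Proof.
move=> yx; rewrite !inE finset.subsetD1 finset.subUset finset.sub1set yx /=.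
case: (boolP (y \in A)) => [yA|yA]; rewrite ?andbF ?andbT // cardsU1 yA add1n.
(* The minimum is positive, by [hB] and [y \in S x], so its truncated predecessor is a true one. *)
rewrite -eqSS prednK // leq_min hB card_gt0.
by apply/set0Pn; exists y.
Qed.

Lemma card_remainders (x w : {set V}) (y : V) : y \in S x -> w \in H x ->
  #|remainders T B x y| = 'C(#|S x|.-1, #|w|.-1).
Proof.
move=> yx /card_hyperchild ->; rewrite /remainders cards_draws.
by rewrite cardsDS ?finset.sub1set// cards1 subn1.
Qed.

(** Double counting: [A = w :\ y] inverts [w = y |: A], so choosing [y] and then the rest amounts to
    choosing [w] and then a point [y] of it. *)
Lemma sum_remainders (U : nmodType) (F : V -> {set V} -> U) (x : {set V}) :
  \sum_(y in S x) \sum_(A in remainders T B x y) F y (y |: A) =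
  \sum_(w in H x) \sum_(y in w) F y w.
Proof.
rewrite [RHS](exchange_big_dep (mem (S x))) /=; last first.
  by move=> w y; rewrite inE => /andP[/fintype.subsetP wS _] /wS.
apply: eq_bigr => y yx.
rewrite [RHS](reindex_onto (fun A => y |: A) (fun w => w :\ y)) /=; last first.
  by move=> w /andP[_ /finset.setD1K].
apply: eq_bigl => A; rewrite mem_remainders // setU11 andbT.
congr (_ && _); apply/idP/eqP => [/setU1K //|<-].
by rewrite setD11.
Qed.

Section Weights.
Context {R : realType} (r : V -> R) (hr : forall v, 0 < r v).

(** The probability that [w] is drawn: any [y] in [w] may come first, with probability
    [r y / node_sum r (S x)], and the rest is then uniform. *)
Definition hyper_prob (x w : {set V}) : R :=
  'C(#|S x|.-1, #|w|.-1)%:R^-1 * (node_sum r w / node_sum r (S x)).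

Lemma node_sum_gt0 (x : {set V}) : x != finset.set0 -> 0 < node_sum r x.
Proof.
case/set0Pn => y yx; rewrite /node_sum (big_setD1 y)//=.
by rewrite ltr_wpDr// sumr_ge0// => v _; exact: ltW.
Qed.

(** Collapses the two-stage draw of the algorithm into a single draw of [w]. *)
Lemma sum_draw (F : {set V} -> R) (x : {set V}) :
  \sum_(y in S x) r y / node_sum r (S x) *
     (\sum_(A in remainders T B x y) #|remainders T B x y|%:R^-1 * F (y |: A)) =
  \sum_(w in H x) hyper_prob x w * F w.
Proof.
transitivity (\sum_(w in H x) \sum_(y in w)
   r y / node_sum r (S x) * 'C(#|S x|.-1, #|w|.-1)%:R^-1 * F w).
  rewrite -(sum_remainders (fun y w =>
     r y / node_sum r (S x) * 'C(#|S x|.-1, #|w|.-1)%:R^-1 * F w)).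
  apply: eq_bigr => y yx; rewrite mulr_sumr; apply: eq_bigr => A Ay.
  have := Ay; rewrite mem_remainders // => /andP[wH _].
  by rewrite (card_remainders yx wH) mulrA.
apply: eq_bigr => w _; rewrite -!mulr_suml /hyper_prob.
by rewrite [X in X * F w]mulrC.
Qed.

(* Each node of [S x] lies in ['C(#|S x|.-1, #|w|.-1)] hyperchildren. *)
Lemma sum_hyperchildren (g : V -> R) (x : {set V}) :
  \sum_(w in H x) 'C(#|S x|.-1, #|w|.-1)%:R^-1 * node_sum g w = node_sum g (S x).
Proof.
under eq_bigr do rewrite /node_sum mulr_sumr.
rewrite -(sum_remainders (fun y w => 'C(#|S x|.-1, #|w|.-1)%:R^-1 * g y)).
apply: eq_bigr => y yx.
rewrite (eq_bigr (fun=> #|remainders T B x y|%:R^-1 * g y)); last first.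
  move=> A; rewrite mem_remainders // => /andP[wH _].
  by rewrite (card_remainders yx wH).
rewrite sumr_const -[LHS]mulr_natl mulrA divff ?mul1r// pnatr_eq0 -lt0n.
exact: card_remainders_gt0.
Qed.

Lemma sum_hyper_prob (x : {set V}) : S x != finset.set0 ->
  \sum_(w in H x) hyper_prob x w = 1.
Proof.
move=> Sx; under eq_bigr do rewrite /hyper_prob mulrA.
by rewrite -mulr_suml sum_hyperchildren divff// gt_eqF// node_sum_gt0.
Qed.

End Weights.
End Hyperchildren.

(** * Moments of the estimator *)

Section SEIMoments.
Context {R : realType} {V : finType} (T : rooted_tree V).
Context (B : nat) (hB : (1 <= B)%N).
Context (c r : V -> R) (hr : forall v, 0 < r v).

Local Notation S := (children_set T).
Local Notation H := (hyperchildren T B).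

(* The expectation of [f (|x| * C_SEI(T_x))], provided that the levels below
   [x] are exhausted after [n] iterations. *)
Fixpoint total_mean (n : nat) (x : {set V}) (f : R -> R) : R :=
  if n isn't n'.+1 then f (node_sum c x) else
  if S x == finset.set0 then f (node_sum c x) else
  \sum_(w in H x) hyper_prob T r x w * total_mean n' w
    (fun t => f (node_sum c x + node_sum r (S x) / node_sum r w * t)).

Lemma eq_total_mean n x f g : f =1 g -> total_mean n x f = total_mean n x g.
Proof. by move=> /funext ->. Qed.

Lemma total_meanD n x f g :
  total_mean n x (fun t => f t + g t) = total_mean n x f + total_mean n x g.
Proof.
elim: n x f g => //= n IH x f g; case: ifP => // _.
by rewrite -big_split /=; apply: eq_bigr => w _; rewrite IH mulrDr.
Qed.

Lemma total_meanZ n x a f :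
  total_mean n x (fun t => a * f t) = a * total_mean n x f.
Proof.
elim: n x f => //= n IH x f; case: ifP => // _.
by rewrite mulr_sumr; apply: eq_bigr => w _; rewrite IH mulrCA.
Qed.

Lemma total_mean_cst n x a : total_mean n x (fun=> a) = a.
Proof.
elim: n x => //= n IH x; case: ifPn => // Sx.
by under eq_bigr do rewrite IH; rewrite -mulr_suml sum_hyper_prob// mul1r.
Qed.

Lemma iter_children_hyperchild n (x w : {set V}) :
  iter n.+1 S x = finset.set0 -> w \in H x -> iter n S w = finset.set0.
Proof.
rewrite iterSr => Sx; rewrite inE => /andP[wS _].
by apply/eqP; rewrite -finset.subset0 -Sx; exact: iter_children_setS.
Qed.

Lemma hyper_prob_ratio (x w : {set V}) : S x != finset.set0 -> w \in H x ->
  hyper_prob T r x w * (node_sum r (S x) / node_sum r w) =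
  'C(#|S x|.-1, #|w|.-1)%:R^-1.
Proof.
move=> Sx wH.
have w0 : w != finset.set0 by rewrite -card_gt0 (card_hyperchild_gt0 hB Sx wH).
have rS := node_sum_gt0 hr Sx; have rw := node_sum_gt0 hr w0.
by rewrite /hyper_prob -mulrA [X in _ * X]mulrA divfK ?divff ?mulr1 ?gt_eqF.
Qed.

Lemma total_mean_id n x : iter n S x = finset.set0 ->
  total_mean n x id = cost_set T c x.
Proof.
elim: n x => [x /= ->|n IH x nx] /=.
  by rewrite /node_sum /cost_set !big_set0.
rewrite cost_setE; case: ifPn => [/eqP ->|Sx].
  by rewrite /cost_set big_set0 addr0.
transitivity (\sum_(w in H x) (hyper_prob T r x w * node_sum c x +
   'C(#|S x|.-1, #|w|.-1)%:R^-1 * cost_set T c w)).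
  apply: eq_bigr => w wH.
  rewrite total_meanD total_mean_cst total_meanZ -(hyper_prob_ratio Sx wH).
  by rewrite mulrDr mulrA IH //; exact: iter_children_hyperchild wH.
by rewrite big_split /= -mulr_suml sum_hyper_prob// mul1r sum_hyperchildren.
Qed.

(** On entry [C] already contains the term of [x], so only [t - node_sum c x] is still to be added,
    scaled by [D / #|x|]. Nonnegativity of [f] lets the integral split over mixtures without
    integrability conditions. *)
Lemma ge0_sei_loop_integral n x D C (f : R -> R) :
  x != finset.set0 -> measurable_fun setT f -> (forall z, 0 <= f z) ->
  (\int[sei_loop T B c hr n x D C]_z (f z)%:E =
  (total_mean n x (fun t => f (C + D * ((t - node_sum c x) / #|x|%:R))%R))%:E)%E.
Proof.
move=> x0 mf f0.
have mEf : measurable_fun setT (fun z => (f z)%:E) by exact/measurable_EFinP.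
elim: n x D C x0 => [|n IH] x D C x0 /=.
  by rewrite integral_dirac// diracT mul1e subrr mul0r mulr0 addr0.
case: ifPn => Sx.
  by rewrite integral_dirac// diracT mul1e subrr mul0r mulr0 addr0.
rewrite ge0_integral_mixture//= -(sum_draw T hB) -sumEFin.
apply: eq_bigr => y yx; rewrite [RHS]EFinM; congr (_ * _)%E.
rewrite ge0_integral_mixture//= -sumEFin.
apply: eq_bigr => A Ay; rewrite [RHS]EFinM; congr (_ * _)%E.
have yA0 : y |: A != finset.set0 by apply/set0Pn; exists y; rewrite setU11.
rewrite IH//; congr (_%:E); apply: eq_total_mean => t; congr (f _).
set w := y |: A in yA0 *.
have w0 : #|w|%:R != 0 :> R by rewrite pnatr_eq0 cards_eq0.
have x0' : #|x|%:R != 0 :> R by rewrite pnatr_eq0 cards_eq0.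
have rw : node_sum r w != 0 by rewrite gt_eqF// node_sum_gt0.
(* The term of [w] added to [C] cancels the subtracted [node_sum c w], and the factor [#|w|] in [D']
   cancels too. *)
by field; rewrite ?w0 ?x0' ?rw.
Qed.

Lemma sei_loop_integral n x D C (f : R -> R) :
  x != finset.set0 -> measurable_fun setT f ->
  (\int[sei_loop T B c hr n x D C]_z (f z)%:E =
  (total_mean n x (fun t => f (C + D * ((t - node_sum c x) / #|x|%:R))%R))%:E)%E.
Proof.
move=> x0 mf; rewrite integralE.
pose fp z := Num.max (f z) 0; pose fn z := Num.max (- f z) 0.
have mfp : measurable_fun setT fp by exact: measurable_maxr.
have mfn : measurable_fun setT fn.
  by apply: measurable_maxr => //; exact: measurableT_comp.
have -> : (fun z => (f z)%:E)^\+%E = (fun z => (fp z)%:E).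
  by apply/funext => z; rewrite funepos.unlock /fp EFin_max.
have -> : (fun z => (f z)%:E)^\-%E = (fun z => (fn z)%:E).
  by apply/funext => z; rewrite funeneg.unlock /fn EFin_max EFinN.
rewrite !ge0_sei_loop_integral//; last 2 first.
  by move=> z; rewrite /fn le_max lexx orbT.
  by move=> z; rewrite /fp le_max lexx orbT.
rewrite -EFinB; congr (_%:E).
(* Both parts have finite integrals, so linearity of [total_mean] recombines them. *)
rewrite -[X in _ + X = _]mulN1r -total_meanZ -total_meanD.
apply: eq_total_mean => t; rewrite mulN1r.
rewrite /fp /fn; set u := f _.
by case: (lerP u 0) => u0; case: (lerP (- u) 0) => v0; lra.
Qed.

(** Any sufficient [n] is allowed because the recursion compares [v] at [(height T).+1] with its
    hyperchildren at [height T]. *)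
Lemma sei_expectation n x (f : R -> R) :
  x != finset.set0 -> (n <= (height T).+1)%N -> iter n S x = finset.set0 ->
  measurable_fun setT f ->
  ('E_(sei T B c hr x)[fun C => f (#|x|%:R * C)%R] = (total_mean n x f)%:E)%E.
Proof.
move=> x0 nh nx mf; rewrite expectation.unlock.
have mfx : measurable_fun setT (fun C : R => f (#|x|%:R * C)).
  exact: measurableT_comp.
rewrite (eq_measure_integral
  (sei_loop T B c hr n x 1 (node_sum c x / #|x|%:R))); last first.
  by move=> U _ _; rewrite /= /sei (sei_loop_stable _ _ _ _ _ _ nx nh).
rewrite (sei_loop_integral _ _ _ x0 mfx); congr (_%:E).
apply: eq_total_mean => t; congr (f _).
by field; rewrite pnatr_eq0 cards_eq0.
Qed.

Lemma sei_variance n x :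
  x != finset.set0 -> (n <= (height T).+1)%N -> iter n S x = finset.set0 ->
  ('V_(sei T B c hr x)[fun C : R => (#|x|%:R * C)%R] =
   (total_mean n x (fun t => (t - cost_set T c x) ^+ 2)%R)%:E)%E.
Proof.
move=> x0 nh nx; rewrite /variance covariance.unlock.
rewrite (sei_expectation (f := id) x0 nh nx)// total_mean_id//=.
rewrite -(sei_expectation (n := n))//.
by apply: measurable_funX; exact: measurable_funB.
Qed.

Lemma total_mean_centered n x : iter n S x = finset.set0 ->
  total_mean n x (fun t => (t - cost_set T c x) ^+ 2) =
  total_mean n x (fun t => t ^+ 2) - cost_set T c x ^+ 2.
Proof.
move=> nx; set m := cost_set T c x.
rewrite (eq_total_mean _ _ (g := fun t => t ^+ 2 + ((- 2 * m) * t + m ^+ 2))).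
  rewrite !total_meanD total_meanZ total_mean_cst total_mean_id// -/m.
  ring.
by move=> t; ring.
Qed.

End SEIMoments.


Theorem theorem4 (R : realType) (V : finType) (T : rooted_tree V)
    (c : V -> R) (hc : forall v : V, 0 <= c v)
    (B : nat) (hB : (1 <= B)%N)
    (r : V -> R) (hr : forall v : V, 0 < r v)
    (v : {set V}) (hv : hypernode T v)
    (hS : children_set T v != finset.set0) :
  ('V_(sei T B c hr v)[fun C : R => (#|v|%:R * C)%R] =
   \sum_(w in hyperchildren T B v)
      ('C(#|children_set T v|.-1, #|w|.-1)%:R^-1
         * (node_sum r (children_set T v) / node_sum r w))%:E
      * ('V_(sei T B c hr w)[fun C : R => (#|w|%:R * C)%R]
         + (cost_set T c w ^+ 2)%:E)
   - (cost_set T c (children_set T v) ^+ 2)%:E)%E.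
Proof.
set S := children_set T; set h := height T.
have hvS : iter h.+1 S v = finset.set0 by exact: iter_children_set0.
have v0 : v != finset.set0.
  by apply: contraNneq hS => ->; rewrite /children_set big_set0.
have hw w : w \in hyperchildren T B v ->
    w != finset.set0 /\ iter h S w = finset.set0.
  move=> wH; split; last exact: iter_children_hyperchild wH.
  by rewrite -card_gt0 (card_hyperchild_gt0 hB hS wH).
rewrite (sei_variance hB c hr v0 (leqnn _) hvS) /= (negPf hS).
(* Variance plus squared mean is the second moment of the hyperchild. *)
under [in RHS]eq_bigr => w wH.
  have [w0 nw] := hw w wH.
  rewrite (sei_variance hB c hr w0 (leqnSn _) nw) total_mean_centered//.
  rewrite -EFinD subrK -EFinM; over.
rewrite sumEFin -EFinB; congr (_%:E).
set K := cost_set T c (S v).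
(* The cost [c(v)] cancels on centering, leaving [(rho * t - K) ^+ 2]; its three terms are kept
   apart. *)
transitivity (\sum_(w in hyperchildren T B v)
  ('C(#|S v|.-1, #|w|.-1)%:R^-1 * (node_sum r (S v) / node_sum r w) *
     total_mean T B c r h w (fun t => t ^+ 2) +
   (- 2 * K * ('C(#|S v|.-1, #|w|.-1)%:R^-1 * cost_set T c w) +
    K ^+ 2 * hyper_prob T r v w))).
  apply: eq_bigr => w wH; have [w0 nw] := hw w wH.
  rewrite -(hyper_prob_ratio hB hr hS wH) cost_setE -/K -/(S v).
  set rho := _ / _; set p := hyper_prob _ _ _ _.
  rewrite (eq_total_mean _ _ _ _ _ _ (g := fun t =>
      rho ^+ 2 * t ^+ 2 + (- 2 * K * rho * t + K ^+ 2))); last first.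
    by move=> t; ring.
  rewrite !total_meanD !total_meanZ total_mean_cst// total_mean_id//.
  ring.
(* The cross terms sum to [- 2 * K * K] and the constants to [K ^+ 2], which leaves [- K ^+ 2]. *)
rewrite !big_split /= -!mulr_sumr sum_hyper_prob// sum_hyperchildren//.
rewrite -[node_sum (cost T c) _]/K -/h.
ring.
Qed.
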